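(* Let $Z$ be a real Banach space with topological dual $Z^*$, and let $Q\subset Z$ be a subset of finite codimension in $Z$. Let $(f_k)_{k\in\mathbb{N}}\subset Z^*$, let $f\in Z^*$, and let $(\epsilon_k)_{k\in\mathbb{N}}$ be a sequence of real numbers with $\epsilon_k\ge 0$ and $\epsilon_k\to 0$, such that (i) there is a real number $\delta>0$ with $\|f_k\|\ge\delta$ for all $k\in\mathbb{N}$, and $f_k\stackrel{w^*}{\rightarrow} f$; (ii) for all $z\in\overline{\mathrm{co}}(Q)$, there exists $C_z\in\mathbb{R}$ such that for all $k\in\mathbb{N}$, $f_k(z)\ge-\epsilon_k C_z$. Then $f\ne 0$.
   Context: $\overline{\mathrm{co}}(X)$ denotes the closed convex hull of $X$. A subset $Q$ of a Banach space $Z$ is said to be of finite codimension in $Z$ if there exists a point $z_0$ in the closed convex hull of $Q$ such that the closed vector space generated by $Q-z_0:=\{q-z_0 : q\in Q\}$ is of finite codimension in $Z$ and the closed convex hull of $Q-z_0$ has nonempty interior in this closed vector space (for its topology inherited from $Z$). The arrow $\stackrel{w^*}{\rightarrow}$ denotes convergence in the weak-star topology of $Z^*$ (pointwise convergence on $Z$). *)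

(* Defs.v *)
From HB Require Import structures.
From mathcomp Require Import all_boot all_order all_algebra.
From mathcomp Require Import all_classical all_reals all_analysis.
Set Implicit Arguments.
Unset Strict Implicit.
Unset Printing Implicit Defensive.
Import Order.TTheory GRing.Theory Num.Theory.
Import numFieldNormedType.Exports.

Local Open Scope classical_set_scope.
Local Open Scope ring_scope.

Definition closed_convex_hull (R : realType) (Z : normedModType R) (Q : set Z) :
  set Z := closure (smallest (@convex_set R Z) Q).

Definition linear_subspace (R : realType) (Z : lmodType R) (V : set Z) : Prop :=
  submod_closed [in V].

Definition closed_span (R : realType) (Z : normedModType R) (A : set Z) :
  set Z := closure (smallest (@linear_subspace R Z) A).

(* dim (Z / V) < oo: the classes of finitely many vectors e i span Z / V. *)
Definition finite_codim_subspace (R : realType) (Z : lmodType R) (V : set Z) :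
  Prop :=
  exists (n : nat) (e : 'I_n -> Z), forall z : Z,
    exists c : 'I_n -> R, V (z - \sum_(i < n) c i *: e i).

(* Points outside V are isolated in [subspace V], so only points of V count as
   interior points; on V the topology of [subspace V] is the induced one. *)
Definition has_relative_interior (T : topologicalType) (V A : set T) : Prop :=
  V `&` interior (A : set (subspace V)) !=set0.

Definition finite_codimension (R : realType) (Z : normedModType R) (Q : set Z) :
  Prop :=
  exists2 z0 : Z, closed_convex_hull Q z0 &
    let Qz0 := [set q - z0 | q in Q] in
    finite_codim_subspace (closed_span Qz0) /\
    has_relative_interior (closed_span Qz0) (closed_convex_hull Qz0).

(* [sup] is a genuine supremum when f is linear and continuous; it is 0 by
   convention on unbounded sets. *)
Definition dual_norm (R : realType) (Z : normedModType R) (f : Z -> R^o) : R :=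
  sup [set `|f z| | z in [set z : Z | `|z| <= 1]].

(* Main.v *)
(* Suppose f = 0. If z0 + v is a point around which the closed convex hull of Q
   contains a ball of z0 + V, V being the closed span of Q - z0, then applying
   (ii) at z0 + v + t w and z0 + v - t w bounds |f_k w|, for every w in V, by
   M_w (eps_k + |f_k (z0 + v)|). As V + span(e_1, ..., e_n) = Z, every z
   satisfies |f_k z| <= M_z a_k with
     a_k = eps_k + |f_k (z0 + v)| + sum_i |f_k (e_i)| + 1 / (k + 1) -> 0.
   By Banach-Steinhaus for f_k / a_k, the norms |f_k| are O(a_k), so they tend
   to 0, contradicting (i). *)
Require Import Defs.
From HB Require Import structures.
From mathcomp Require Import all_boot all_order all_algebra.
From mathcomp Require Import all_classical all_reals all_analysis.
From mathcomp Require Import lra.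
Import Order.TTheory GRing.Theory Num.Theory.
Import numFieldNormedType.Exports.

Local Open Scope classical_set_scope.
Local Open Scope ring_scope.

Lemma closure_sub_preimage (T U : topologicalType) (g : T -> U) (A : set T)
    (B : set U) : continuous g -> A `<=` g @^-1` B ->
  closure A `<=` g @^-1` closure B.
Proof.
move=> cg AB x Ax N /cg /Ax [y [Ay Ny]].
by exists (g y); split => //; exact: AB.
Qed.

(** Translation by [z0] is continuous and affine, so it respects convex hulls and passes to their
    closures. *)
Lemma closed_convex_hull_translate (R : realType) (Z : normedModType R)
    (Q : set Z) (z0 z : Z) :
  closed_convex_hull [set q - z0 | q in Q] z -> closed_convex_hull Q (z + z0).
Proof.
apply: (@closure_sub_preimage _ _ (fun y : Z => y + z0)).
  by move=> y; apply: cvgD; [exact: cvg_id|exact: cvg_cst].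
apply: smallest_sub => [x y l|_ [q Qq <-] /=]; last first.
  by rewrite subrK; exact: sub_gen_smallest.
rewrite !inE => Hx Hy C [cC QC].
have := cC _ _ l (mem_set (Hx C (conj cC QC))) (mem_set (Hy C (conj cC QC))).
rewrite inE; congr C; rewrite /conv /=.
(* The weights of a convex combination add up to 1, so shifting both points by [z0] shifts the
   combination by [z0]. *)
by rewrite !scalerDr addrACA -[in RHS](scale1r z0) -scalerDl
  addrC [l%:num + _]addrC subrK addrC.
Qed.

(** The algebraic span is stable under linear combinations; continuity in one variable at a time
    extends this to the closure, first in [u], then in [v]. *)
Lemma closed_span_linear {R : realType} {Z : normedModType R} {A : set Z}
    (a : R) {u v : Z} :
  closed_span A u -> closed_span A v -> closed_span A (a *: u + v).
Proof.
have lin x y : smallest (@linear_subspace R Z) A x ->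
    smallest (@linear_subspace R Z) A y ->
    smallest (@linear_subspace R Z) A (a *: x + y).
  move=> Ax Ay C [[C0 Clin] AC].
  have := Clin a x y; rewrite !inE; apply; [exact: Ax|exact: Ay].
have linl x y : closed_span A x -> smallest (@linear_subspace R Z) A y ->
    closed_span A (a *: x + y).
  move=> Ax Ay; apply: (@closure_sub_preimage _ _ (fun x : Z => a *: x + y)) Ax.
    move=> x'; apply: cvgD; last exact: cvg_cst.
    by apply: cvgZ; [exact: cvg_cst|exact: cvg_id].
  by move=> x' Ax'; exact: lin.
(* The passage to the limit in [v] lands in a closure of a closure, which is the closed span
   again. *)
move=> Au Av; have /closure_id clcl :=
  @closed_closure _ (smallest (@linear_subspace R Z) A).
rewrite /closed_span clcl.
apply: (@closure_sub_preimage _ _ (fun y : Z => a *: u + y)) Av.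
  by move=> y; apply: cvgD; [exact: cvg_cst|exact: cvg_id].
by move=> y Ay; exact: linl.
Qed.

Lemma relative_interior_ball {R : realType} {Z : normedModType R}
    {V A : set Z} :
  has_relative_interior V A ->
  exists2 v, V v & exists2 r : R, 0 < r &
    forall w, V w -> `|w - v| < r -> A w.
Proof.
move=> [v [Vv]]; rewrite /interior /= /nbhs /= /nbhs_subspace (mem_set Vv) => vA.
exists v => //; move: vA => /nbhs_normP[r /= r0 rA]; exists r => // w Vw wvr.
by apply: rA => //=; rewrite /ball_ /= distrC.
Qed.

(** For small [t], moving from [x] by [t *: w] or by its opposite stays in [P]; the one-sided bounds
    at these two points bound [f_ k w] from both sides. *)
Lemma pointwise_dominated_subspace {R : realType} {Z : normedModType R}
    {V P : set Z} {f_ : nat -> {linear Z -> R^o}} {eps : nat -> R} {x : Z}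
    {r : R} :
  (forall k, 0 <= eps k) ->
  (forall z, P z -> exists C : R, forall k, - (eps k * C) <= f_ k z) ->
  (forall (a : R) w, V w -> V (a *: w)) -> 0 < r ->
  (forall w, V w -> `|w| < r -> P (x + w)) ->
  forall w, V w -> exists M : R, forall k,
    `|f_ k w| <= M * (eps k + `|f_ k x|).
Proof.
move=> eps0 f_lower Vscale r0 Pr w Vw.
have [t t0 tw] : exists2 t : R, 0 < t & `|t *: w| < r.
  (* Adding 1 keeps the denominator positive when [w = 0] and makes the bound on the norm of
     [t *: w] strict. *)
  have w1 : 0 < `|w| + 1 by rewrite ltr_wpDl.
  exists (r / (`|w| + 1)); first by rewrite divr_gt0.
  rewrite normrZ ger0_norm ?divr_ge0 1?ltW// mulrAC ltr_pdivrMr//.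
  by rewrite ltr_pM2l// ltrDl.
have [C1 HC1] := f_lower _ (Pr _ (Vscale t _ Vw) tw).
have tw' : `|(- t) *: w| < r by rewrite scaleNr normrN.
have [C2 HC2] := f_lower _ (Pr _ (Vscale (- t) _ Vw) tw').
(* The norms of [C1] and [C2] absorb the [eps k] terms, 1 absorbs [f_ k x], and division by [t]
   undoes the scaling of [w]. *)
exists ((`|C1| + `|C2| + 1) / t) => k.
rewrite mulrAC ler_pdivlMr// mulrC -[X in X * _](gtr0_norm t0) -normrM.
move: (HC1 k) (HC2 k); rewrite !(linearD (f_ k)) !(linearZ_LR (f_ k)) => h1 h2.
have {}h1 : - (eps k * C1) <= f_ k x + t * f_ k w := h1.
have {}h2 : - (eps k * C2) <= f_ k x + (- t) * f_ k w := h2.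
have le1 := ler_norm C1; have le2 := ler_norm C2; have lex := ler_norm (f_ k x).
have n1 := normr_ge0 C1; have n2 := normr_ge0 C2; have nx := normr_ge0 (f_ k x).
have e0 := eps0 k.
(* For [lra] products are atoms, so the inequalities on the cross terms are supplied beforehand. *)
have p1 : eps k * C1 <= eps k * `|C1| by exact: ler_wpM2l.
have p2 : eps k * C2 <= eps k * `|C2| by exact: ler_wpM2l.
have p3 := mulr_ge0 n1 nx; have p4 := mulr_ge0 n2 nx.
have p5 := mulr_ge0 e0 n1; have p6 := mulr_ge0 e0 n2.
rewrite ler_norml; apply/andP; split; lra.
Qed.

(** Split [z] into a part in [V], controlled by [b], and a combination of the [e i], controlled by
    the added sum. *)
Lemma pointwise_dominated {R : realType} {Z : lmodType R} {n : nat}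
    {V : set Z} {e : 'I_n -> Z} {f_ : nat -> {linear Z -> R^o}} {b : nat -> R} :
  (forall k, 0 <= b k) ->
  (forall z, exists c : 'I_n -> R, V (z - \sum_(i < n) c i *: e i)) ->
  (forall w, V w -> exists M : R, forall k, `|f_ k w| <= M * b k) ->
  forall z, exists M : R, forall k,
    `|f_ k z| <= M * (b k + \sum_(i < n) `|f_ k (e i)|).
Proof.
move=> b0 Ve Vdom z; have [c Vc] := Ve z; have [M HM] := Vdom _ Vc.
exists (`|M| + \sum_(i < n) `|c i|) => k.
have s0 : 0 <= \sum_(i < n) `|f_ k (e i)| by exact: sumr_ge0.
have c0 : 0 <= \sum_(i < n) `|c i| by exact: sumr_ge0.
rewrite -[z](subrK (\sum_(i < n) c i *: e i)) (linearD (f_ k)) (linear_sum (f_ k)).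
rewrite mulrDl; apply: le_trans (ler_normD _ _) _; apply: lerD.
  rewrite (le_trans (HM k))// (le_trans (ler_wpM2r (b0 k) (ler_norm M)))//.
  by rewrite ler_wpM2l// lerDl.
rewrite (le_trans (ler_norm_sum _ _ _))// mulr_suml; apply: ler_sum => i _.
rewrite linearZ /= normrM ler_wpM2l// (bigD1 i)//= addrCA lerDl addr_ge0//.
exact: sumr_ge0.
Qed.

Lemma dual_norm_dominated {R : realType} {Z : completeNormedModType R}
    {f_ : nat -> {linear Z -> R^o}} {a : nat -> R} :
  (forall k, continuous (f_ k)) -> (forall k, 0 < a k) ->
  (forall z, exists M : R, forall k, `|f_ k z| <= M * a k) ->
  exists M : R, forall k, dual_norm (f_ k) <= M * a k.
Proof.
move=> fc a0 dom.
pose g k : {linear Z -> R^o} := (a k)^-1 \*: f_ k.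
have gE k z : `|g k z| = `|f_ k z| / a k.
  by rewrite /= normrZ gtr0_norm ?invr_gt0// mulrC.
have gbnd h : [set (g k : Z -> R^o) | k in setT] h ->
    bounded_fun_norm h /\ linear h.
  move=> [k _ <-]; split; last exact: linearP.
  apply/bounded_funP/linear_bounded_continuous => z.
  by apply: cvgZ; [exact: cvg_cst|exact: fc].
have gpt : pointwise_bounded [set (g k : Z -> R^o) | k in setT].
  move=> z; have [M HM] := dom z; exists M => _ [k _ <-].
  by rewrite gE ler_pdivrMr.
(* Radius 1 matches the unit ball in [dual_norm]. *)
have [M HM] := Banach_Steinhauss gbnd gpt 1.
exists M => k; apply: ge_sup.
  (* Bounding a supremum by [ge_sup] requires a nonempty set. *)
  by exists `|f_ k 0|, 0 => //=; rewrite normr0.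
move=> _ [z /= z1 <-]; rewrite -ler_pdivrMr// -gE.
by apply: HM => //; exists k.
Qed.

Theorem corollary2 (R : realType) (Z : completeNormedModType R) (Q : set Z)
    (f_ : nat -> {linear Z -> R^o}) (f : {linear Z -> R^o}) (eps : nat -> R)
    (Q_fincodim : finite_codimension Q)
    (f_continuous : forall k, continuous (f_ k))
    (f_lim_continuous : continuous f)
    (eps_ge0 : forall k, 0 <= eps k)
    (eps_cvg0 : eps k @[k --> \oo] --> (0 : R))
    (f_norm_ge : exists2 delta : R, 0 < delta &
                   forall k, delta <= dual_norm (f_ k))
    (f_weak_star_cvg : {ptws, (fun k => f_ k : Z -> R^o) @ \oo --> (f : Z -> R^o)})
    (f_lower : forall z : Z, closed_convex_hull Q z ->
                 exists C : R, forall k, - (eps k * C) <= f_ k z) :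
  (f : Z -> R^o) <> \0.
Proof.
move=> f0.
have [z0 _ /= []] := Q_fincodim.
set V := closed_span _.
move=> [n [e Ve]] /relative_interior_ball[v Vv [r r0 Hr]].
have V0 : V 0.
  by have := closed_span_linear (-1) Vv Vv; rewrite scaleN1r addNr.
have Vscale (a : R) w : V w -> V (a *: w).
  by move=> Vw; have := closed_span_linear a Vw V0; rewrite addr0.
have VP w : V w -> `|w| < r -> closed_convex_hull Q ((v + z0) + w).
  move=> Vw wr; rewrite addrAC; apply: closed_convex_hull_translate.
  apply: Hr; last by rewrite addrAC subrr add0r.
  by rewrite addrC -[w]scale1r; exact: closed_span_linear.
have Vdom := pointwise_dominated_subspace eps_ge0 f_lower Vscale r0 VP.
pose b k := eps k + `|f_ k (v + z0)|.
have b0 k : 0 <= b k by rewrite addr_ge0.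
have dom := pointwise_dominated b0 Ve Vdom.
pose s k : R := \sum_(i < n) `|f_ k (e i)|.
(* The harmonic term makes [a k] strictly positive, so that one can divide by it, and still tends to
   0. *)
pose a k := b k + s k + harmonic k.
have s0 k : 0 <= s k by exact: sumr_ge0.
have a0 k : 0 < a k by rewrite ltr_wpDl ?addr_ge0 ?harmonic_gt0.
have f_cvg0 z : f_ k z @[k --> \oo] --> (0 : R).
  by have /pointwise_cvgP/(_ z) := f_weak_star_cvg; rewrite f0.
have norm_cvg0 z : `|f_ k z| @[k --> \oo] --> (0 : R).
  by rewrite -(normr0 R); apply: cvg_norm; exact: f_cvg0.
have a_cvg0 : a k @[k --> \oo] --> (0 : R).
  rewrite -[X in _ --> X](addr0 0); apply: cvgD; last exact: cvg_harmonic.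
  rewrite -[X in _ --> X](addr0 0); apply: cvgD.
    by rewrite -[X in _ --> X](addr0 0); apply: cvgD.
  rewrite /s; rewrite [X in _ --> X](_ : 0 = \sum_(i < n) 0); last by rewrite big1.
  by apply: cvg_big => [|i _]; [exact: add_continuous|exact: norm_cvg0].
have [M HM] : exists M : R, forall k, dual_norm (f_ k) <= M * a k.
  apply: dual_norm_dominated => // z; have [M HM] := dom z.
  (* The constant must be nonnegative for the bound to survive the addition of the harmonic term. *)
  exists `|M| => k; rewrite (le_trans (HM k))//.
  have bs0 : 0 <= b k + s k by exact: addr_ge0.
  rewrite (le_trans (ler_wpM2r bs0 (ler_norm M)))// ler_wpM2l//.
  by rewrite /a /s lerDl harmonic_ge0.
have [delta delta0 Hdelta] := f_norm_ge.
(* The lower bound [delta] passes to the limit in [M * a k]. *)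
have : delta <= M * 0.
  have lim : M * a k @[k --> \oo] --> M * 0.
    by apply: cvgM => //; exact: cvg_cst.
  apply: (cvgr_to_ge lim).
  by apply: nearW => k; exact: le_trans (HM k).
by rewrite mulr0 leNgt delta0.
Qed.
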